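(* Consider scalar linear advection $u_t+au_x=0$ with $a>0$ in one space dimension, on a grid of background cell width $h$ with one small cut cell $j$ of volume fraction $\alpha<1/2$ (length $\alpha h$, $0<\alpha<1/2$) merged to the left with cell $j-1$, with first-order upwind flux $F(U_i,U_{i+1})=aU_i$ and CFL condition $a\,\Delta t/h\le1$. With the blending parameter computed from the normalized indicator $\eta_j$, UM-SRD (update-magnitude state redistribution) remains first-order accurate: for smooth solutions, $$\|\tau^{n,\mathrm{UM}}-\tau^{n,\mathrm{base}}\|_\infty=\mathcal{O}(h),$$ where $\tau^{n,\mathrm{UM}}$ and $\tau^{n,\mathrm{base}}$ are the truncation errors of UM-SRD and of the base scheme.
   Context: $B$ denotes one application of the base first-order upwind finite-volume scheme (in the time-step composition $U^{n+1}=R\circ B\circ P(U^n)$, with $P$ the pre-merging operator and $R$ the blended redistribution, $B$ is the finite-volume update on the merged mesh). $U^*$ denotes the cell averages after the finite-volume update of $U^n$ and before redistribution. On the neighborhood $M_j=\{j-1,j\}$, UM-SRD applies $R_j(s_j^n)=(1-s_j^n)\,\mathrm{Id}+s_j^nS_j$ to the result of the base scheme, so that $U^{n+1,\mathrm{UM}}-U^{n+1,\mathrm{base}}=s_j^n(S_j-\mathrm{Id})U^{n+1,\mathrm{base}}$; elsewhere it acts as the identity. $S_j$ is the state redistribution (SRD) operator, which in this one-small-cell merging-left configuration satisfies $$[(S_j-\mathrm{Id})V]_{j-1}=\alpha(V_j-V_{j-1}),\qquad[(S_j-\mathrm{Id})V]_j=(1-\alpha)(V_{j-1}-V_j),$$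 and $(S_j-\mathrm{Id})V=0$ at all other indices; $\mathrm{Id}$ is the identity. Normalized indicator and blending parameter, with fixed $p\ge1$, $\tau_*>0$, $\varepsilon>0$: $$\Delta U_{\max,j}=\max_{i\in M_j}\|U_i^*-U_i^n\|_2,\qquad \eta_j=\frac{\Delta U_{\max,j}}{\varepsilon+\Delta U_{\max,j}},\qquad s_j^n=\frac{\eta_j^p}{\eta_j^p+\tau_*^p}.$$ The truncation errors satisfy $\tau^{n,\mathrm{UM}}-\tau^{n,\mathrm{base}}=s_j^n(S_j-\mathrm{Id})B(u^n)$, where $u^n$ is the exact solution on the grid at time $t_n=n\Delta t$. *)

(* Defs.v *)
From HB Require Import structures.
From mathcomp Require Import all_boot all_order all_algebra.
From mathcomp Require Import all_classical all_reals all_analysis.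
From mathcomp Require Import ring.
Set Implicit Arguments.
Unset Strict Implicit.
Unset Printing Implicit Defensive.
Import Order.TTheory GRing.Theory Num.Theory.
Import numFieldNormedType.Exports.
Local Open Scope classical_set_scope.
Local Open Scope ring_scope.

(* Functions of (t, x) are uncurried.  Partial derivatives: *)
Definition dt_ {R : realType} (u : R * R -> R) (z : R * R) : R :=
  derive1 (fun s : R => u (s, z.2)) z.1.

Definition dx_ {R : realType} (u : R * R -> R) (z : R * R) : R :=
  derive1 (fun y : R => u (z.1, y)) z.2.

Fixpoint Ck {R : realType} (k : nat) (u : R * R -> R) : Prop :=
  continuous u /\
  match k with
  | 0%N => True
  | k'.+1 =>
      [/\ forall t x : R, derivable (fun s : R => u (s, x)) t 1,
          forall t x : R, derivable (fun y : R => u (t, y)) x 1,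
          Ck k' (dt_ u) & Ck k' (dx_ u)]
  end.

Definition smooth {R : realType} (u : R * R -> R) : Prop :=
  forall k : nat, Ck k u.

Definition advection_solution {R : realType} (a : R) (u : R * R -> R) : Prop :=
  forall t x : R, dt_ u (t, x) + a * dx_ u (t, x) = 0.

(* Cells are indexed by int.  Cell [jcut] has left edge [origin] and length
   vfrac * bgw, its left neighbour has length lfrac * bgw, all others length bgw.
   If the cut point splits one background cell, then lfrac = 1 - vfrac; if the
   left neighbour is a full background cell, then lfrac = 1. *)
Record cut_mesh (R : realType) := CutMesh {
  bgw : R;
  vfrac : R;
  lfrac : R;
  jcut : int;
  origin : R }.

Section Scheme.
Context {R : realType}.
Implicit Types (m : cut_mesh R) (U V : int -> R) (i : int) (u : R * R -> R).

Definition width m i : R :=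
  if i == jcut m then vfrac m * bgw m
  else if i == jcut m - 1 then lfrac m * bgw m
  else bgw m.

(* Left edge of cell i. *)
Definition edge m i : R :=
  if (i < jcut m)%R then
    origin m - lfrac m * bgw m - (jcut m - 1 - i)%:~R * bgw m
  else if i == jcut m then origin m
  else origin m + vfrac m * bgw m + (i - jcut m - 1)%:~R * bgw m.

Lemma edge_succ m i : edge m (i + 1) = edge m i + width m i.
Proof.
rewrite /edge /width; case: (ltgtP i (jcut m)) => [lic|cli|->].
- have [->|nic] := eqVneq i (jcut m - 1).
    by rewrite subrK ltxx eqxx !subrr mul0r subr0 addrNK.
  have -> : (i + 1 < jcut m)%R.
    rewrite lt_neqAle lezD1 lic andbT; apply: contra nic => /eqP <-.
    by rewrite addrK.
  have -> : jcut m - 1 - i = jcut m - 1 - (i + 1) + 1 by ring.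
  by rewrite [in RHS]rmorphD/= mulrDl mul1r; ring.
- have ci : (jcut m < i + 1)%R by rewrite ltzD1 ltW.
  rewrite ltNge (ltW ci)/= (gt_eqF ci).
  have -> : (i == jcut m - 1) = false by apply: gt_eqF; rewrite ltrBlDr.
  have -> : i + 1 - jcut m - 1 = i - jcut m - 1 + 1 by ring.
  by rewrite [in LHS]rmorphD/= mulrDl mul1r addrA.
- have ci : (jcut m < jcut m + 1)%R by rewrite ltzD1.
  rewrite ltNge (ltW ci)/= (gt_eqF ci).
  by rewrite [jcut m + 1]addrC addrK subrr mul0r addr0.
Qed.

(* The exact solution on the grid: cell averages at time t. *)
Definition grid_avg m u (t : R) i : R :=
  (width m i)^-1 *
  \int[lebesgue_measure]_(x in `[edge m i, edge m (i + 1)]) u (t, x).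

Definition upwind_flux (a Ul Ur : R) : R := a * Ul.

Definition base_step m (a dt : R) U i : R :=
  U i - dt / width m i *
        (upwind_flux a (U i) (U (i + 1)) - upwind_flux a (U (i - 1)) (U i)).

Definition nbhd m : seq int := [:: jcut m - 1; jcut m].

(* [srd m V (jcut m - 1)] and [srd m V (jcut m)] both equal
   (1 - vfrac m) * V (jcut m - 1) + vfrac m * V (jcut m). *)
Definition srd m V i : R :=
  V i + (if i == jcut m - 1 then vfrac m * (V (jcut m) - V (jcut m - 1))
         else if i == jcut m then (1 - vfrac m) * (V (jcut m - 1) - V (jcut m))
         else 0).

(* U is scalar, so the Euclidean norm of an update is its absolute value. *)
Definition max_update m U Ustar : R :=
  \big[Num.max/0]_(i <- nbhd m) `|Ustar i - U i|.

Definition indicator m (eps : R) U Ustar : R :=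
  max_update m U Ustar / (eps + max_update m U Ustar).

Definition blending m (p taus eps : R) U Ustar : R :=
  let e := indicator m eps U Ustar in e `^ p / (e `^ p + taus `^ p).

Definition redistribute m (s : R) V i : R := (1 - s) * V i + s * srd m V i.

Definition um_step m (a dt p taus eps : R) U : int -> R :=
  let Ustar := base_step m a dt U in
  redistribute m (blending m p taus eps U Ustar) Ustar.

(* One-step error at t_n = n * dt, not divided by dt: this is the normalization
   for which [trunc_diffE] holds. *)
Definition trunc m (step : (int -> R) -> int -> R) (dt : R) u (n : nat) i : R :=
  step (grid_avg m u (n%:R * dt)) i - grid_avg m u (n.+1%:R * dt) i.

Definition trunc_base m (a dt : R) u n : int -> R :=
  trunc m (base_step m a dt) dt u n.

Definition trunc_um m (a dt p taus eps : R) u n : int -> R :=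
  trunc m (um_step m a dt p taus eps) dt u n.

Lemma trunc_diffE m a dt p taus eps u n i :
  let un := grid_avg m u (n%:R * dt) in
  let Bun := base_step m a dt un in
  trunc_um m a dt p taus eps u n i - trunc_base m a dt u n i =
  blending m p taus eps un Bun * (srd m Bun i - Bun i).
Proof.
rewrite /= /trunc_um /trunc_base /trunc /um_step /redistribute/=.
by ring.
Qed.

(* Sup norm over all cells, in the extended reals. *)
Definition sup_norm (v : int -> R) : \bar R :=
  ereal_sup [set `|v i|%:E | i in [set: int]].

End Scheme.

(* Main.v *)
Require Import Defs.
From HB Require Import structures.
From mathcomp Require Import all_boot all_order all_algebra.
From mathcomp Require Import all_classical all_reals all_analysis.
From mathcomp Require Import ring lra zify.
Set Implicit Arguments.
Unset Strict Implicit.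
Unset Printing Implicit Defensive.
Import Order.TTheory GRing.Theory Num.Theory.
Import numFieldNormedType.Exports.
Local Open Scope classical_set_scope.
Local Open Scope ring_scope.

(** UM-SRD differs from the base scheme by [s * (srd V - V)] with
    [V = base_step U], [U] the exact cell averages and [s] in [0, 1]; so
    the difference is bounded by the jump [V j - V (j - 1)] over the merging
    neighbourhood ([blending_itv], [srd_dist_le]), which has to be O(h).

    By smoothness, [u] is Lipschitz in [x], with one constant [L] on a compact
    box that contains all the relevant cells for every admissible time step and
    grid with [h <= 1] ([smooth_lipschitz_x]).  The three cells
    [j - 2], [j - 1], [j] that determine [V j] and [V (j - 1)] lie within [2 h]
    of the cut point, so their averages are within [2 L h] of the value of [u]
    there ([grid_avg_dist_le]) and within [4 L h] of one another.  One upwind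
    step multiplies such jumps by at most a constant: the effective Courant
    number of the small cell may exceed 1, but the CFL condition on the
    background width bounds it by [1 / alpha], with [alpha] fixed
    ([base_step_jump_le]).  Hence the constant [(3 + 1 / alpha) * 4 L]. *)

(** The continuous function [dx_ u] is bounded on the compact box, and the mean
    value theorem in [x] turns this bound into a Lipschitz constant; it is
    uniform in [t] because the box includes the time interval. *)
Lemma smooth_lipschitz_x (R : realType) (u : R * R -> R) (T x1 x2 : R) :
  smooth u -> exists2 L : R, 0 <= L & forall t x y : R,
    0 <= t <= T -> x1 <= x <= x2 -> x1 <= y <= x2 ->
    `|u (t, y) - u (t, x)| <= L * `|y - x|.
Proof.
move=> /(_ 1%N) [_ [_ dux _ [cdx _]]].
pose K : set (R * R) := `[0, T]%classic `*` `[x1, x2]%classic.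
have : bounded_set (dx_ u @` K).
  apply: compact_bounded; apply: continuous_compact.
    exact: continuous_subspaceT.
  by apply: compact_setX; exact: segment_compact.
move=> /pinfty_ex_gt0[L L0 HL].
exists L; first exact: ltW.
have leL z : K z -> `|dx_ u z| <= L by move=> Kz; apply: HL; exists z.
move=> t x y tT.
wlog xy : x y / x <= y => [wl|] hx hy.
  have [xy|/ltW yx] := leP x y; first exact: wl.
  by rewrite distrC [`|y - x|]distrC; exact: wl.
have [||c cxy ->] := @MVT_segment R (fun s => u (t, s))
    (fun s => dx_ u (t, s)) x y xy.
- by move=> c _; rewrite /dx_/= derive1E; exact/derivableP.
- apply: continuous_subspaceT => c.
  by apply/differentiable_continuous/derivable1_diffP; exact: dux.
rewrite normrM ler_wpM2r//; apply: leL; split;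
  rewrite /= in_itv/=; first exact: tT.
by move: cxy hx hy; rewrite in_itv/=; lra.
Qed.

Lemma average_dist_le (R : realType) (f : R -> R) (l r c e : R) :
  l < r -> continuous f -> (forall x, l <= x <= r -> `|f x - c| <= e) ->
  `|(r - l)^-1 * (\int[lebesgue_measure]_(x in `[l, r]) f x) - c| <= e.
Proof.
move=> lr cf fce.
have rl : 0 < r - l by rewrite subr_gt0.
have mI : fine (@lebesgue_measure R `[l, r]%classic) = r - l.
  by rewrite lebesgue_measure_itv/= lte_fin lr.
have integ (g : R -> R) : continuous g ->
    lebesgue_measure.-integrable `[l, r]%classic (EFin \o g).
  move=> cg; apply: continuous_compact_integrable; first exact: segment_compact.
  exact: continuous_subspaceT.
have icst k := integ (fun=> k) (fun=> cvg_cst k).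
have cst_int k : \int[lebesgue_measure]_(x in `[l, r]) k = k * (r - l).
  by rewrite Rintegral_cst// mI.
have ub : \int[lebesgue_measure]_(x in `[l, r]) f x <= (c + e) * (r - l).
  rewrite -cst_int; apply: le_Rintegral => //; [exact: integ|exact: icst|].
  by move=> x /=; rewrite in_itv/= => /fce; rewrite ler_norml; lra.
have lb : (c - e) * (r - l) <= \int[lebesgue_measure]_(x in `[l, r]) f x.
  rewrite -cst_int; apply: le_Rintegral => //; [exact: icst|exact: integ|].
  by move=> x /=; rewrite in_itv/= => /fce; rewrite ler_norml; lra.
rewrite ler_norml; apply/andP; split.
  by rewrite lerBrDl mulrC ler_pdivlMr.
by rewrite lerBlDl mulrC ler_pdivrMr.
Qed.

(** The quotient has the form [x / (x + y)] with [0 <= x] and [0 < y]: a real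
    power is nonnegative whatever the sign of its base. *)
Lemma blending_itv (R : realType) (m : cut_mesh R) (p taus eps : R)
    (U V : int -> R) :
  0 < taus -> 0 <= blending m p taus eps U V <= 1.
Proof.
move=> t0; rewrite /blending/=.
have A := powR_ge0 (indicator m eps U V) p.
have B := powR_gt0 p t0.
have AB := ltr_wpDl A B.
by rewrite divr_ge0 ?(ltW AB)//= ler_pdivrMr// mul1r lerDl ltW.
Qed.

(** Redistribution moves both merged values to a common convex combination, so
    neither moves further than their distance. *)
Lemma srd_dist_le (R : realType) (m : cut_mesh R) (V : int -> R) (i : int) :
  0 <= vfrac m <= 1 ->
  `|srd m V i - V i| <= `|V (jcut m) - V (jcut m - 1)|.
Proof.
move=> /andP[v0 v1]; rewrite /srd addrC addKr.
case: ifP => _; [|case: ifP => _]; last by rewrite normr0.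
  by rewrite normrM ger0_norm// ler_piMl.
by rewrite distrC normrM ger0_norm ?subr_ge0// ler_piMl// gerBl.
Qed.

(** With [h] the background width, [c = a dt / h], and [v], [k] the fractions of
    the cut cell and of its left neighbour, the new jump is
    [(1 - c / v) * (U j - U (j - 1)) + (c / k) * (U (j - 1) - U (j - 2))].
    The first coefficient is at most [1 + 1 / v] in absolute value, and the
    second at most [2] because [k >= 1 / 2]. *)
Lemma base_step_jump_le (R : realType) (m : cut_mesh R) (a dt D : R)
    (U : int -> R) :
  0 < vfrac m -> 1 / 2 <= lfrac m -> 0 < bgw m -> 0 <= a * dt / bgw m <= 1 ->
  `|U (jcut m) - U (jcut m - 1)| <= D ->
  `|U (jcut m - 1) - U (jcut m - 1 - 1)| <= D ->
  `|base_step m a dt U (jcut m) - base_step m a dt U (jcut m - 1)|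
    <= (3 + (vfrac m)^-1) * D.
Proof.
move=> v0 l0 h0 /andP[c0 c1] D1 D2.
have nj : (jcut m - 1 == jcut m) = false by apply/eqP; lia.
set c := a * dt / bgw m in c0 c1.
set v := vfrac m in v0 *; set k := lfrac m in l0 *.
have k0 : 0 < k by lra.
have -> : base_step m a dt U (jcut m) - base_step m a dt U (jcut m - 1) =
    (1 - c / v) * (U (jcut m) - U (jcut m - 1))
    + c / k * (U (jcut m - 1) - U (jcut m - 1 - 1)).
  rewrite /base_step /upwind_flux /width eqxx nj eqxx /c -/v -/k.
  by field; rewrite !gt_eqF.
have D0 : 0 <= D := le_trans (normr_ge0 _) D1.
have cv : 0 <= c / v <= v^-1.
  by rewrite divr_ge0 ?(ltW v0)//= ler_piMl// invr_ge0 ltW.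
have ck : 0 <= c / k <= 2.
  by rewrite divr_ge0 ?(ltW k0)//= ler_pdivrMr//; lra.
apply: le_trans (ler_normD _ _) _.
rewrite (normrM (1 - c / v)) (normrM (c / k)).
have -> : (3 + v^-1) * D = (1 + v^-1) * D + 2 * D by ring.
apply: lerD; apply: ler_pM => //; rewrite ler_norml; lra.
Qed.

(** The three cells extend at most two background widths to the left of the cut
    point (the left neighbour and one full cell) and one to the right, and an
    average inherits a pointwise bound on the distance to a constant. *)
Lemma grid_avg_dist_le (R : realType) (m : cut_mesh R) (u : R * R -> R)
    (t L : R) (i : int) :
  continuous (fun x => u (t, x)) -> 0 <= L ->
  0 < bgw m -> 0 < vfrac m <= 1 -> 0 < lfrac m <= 1 ->
  (forall x, origin m - 2 * bgw m <= x <= origin m + bgw m ->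
     `|u (t, x) - u (t, origin m)| <= L * `|x - origin m|) ->
  i \in [:: jcut m; jcut m - 1; jcut m - 1 - 1] ->
  `|grid_avg m u t i - u (t, origin m)| <= 2 * L * bgw m.
Proof.
move=> cu L0 h0 /andP[v0 v1] /andP[k0 k1] lip hi.
have vh : 0 < vfrac m * bgw m <= bgw m by rewrite mulr_gt0//= ler_piMl// ltW.
have kh : 0 < lfrac m * bgw m <= bgw m by rewrite mulr_gt0//= ler_piMl// ltW.
have [w0 el er] : [/\ 0 < width m i, origin m - 2 * bgw m <= edge m i &
    edge m i + width m i <= origin m + bgw m].
  have n1 : (jcut m - 1 == jcut m) = false by apply/eqP; lia.
  have n2 : (jcut m - 1 - 1 == jcut m) = false by apply/eqP; lia.
  have n3 : (jcut m - 1 - 1 == jcut m - 1) = false by apply/eqP; lia.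
  have e0 : edge m (jcut m) = origin m by rewrite /edge ltxx eqxx.
  have w1 : width m (jcut m - 1) = lfrac m * bgw m by rewrite /width n1 eqxx.
  have w2 : width m (jcut m - 1 - 1) = bgw m by rewrite /width n2 n3.
  have := edge_succ m (jcut m - 1); rewrite subrK e0 w1 => e1.
  have := edge_succ m (jcut m - 1 - 1); rewrite subrK w2 => e2.
  by move: hi; rewrite !inE => /or3P[] /eqP ->; split;
    rewrite ?w1 ?w2 ?e0 /width ?eqxx//; lra.
rewrite /grid_avg edge_succ.
have {1}-> : width m i = edge m i + width m i - edge m i by ring.
apply: average_dist_le => [||x hx]; [by rewrite ltrDl|exact: cu|].
have hx' : origin m - 2 * bgw m <= x <= origin m + bgw m by lra.
apply: le_trans (lip x hx') _; rewrite [2 * L]mulrC -mulrA ler_wpM2l//.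
by rewrite ler_norml; lra.
Qed.

Theorem proposition2 (R : realType)
  (a alpha kappa p taus eps : R)
  (ha : 0 < a) (halpha : 0 < alpha < 1 / 2) (hkappa : 1 / 2 <= kappa <= 1)
  (hp : 1 <= p) (htaus : 0 < taus) (heps : 0 < eps)
  (u : R * R -> R) (hu : smooth u) (hadv : advection_solution a u)
  (T xmin xmax : R) :
  exists C : R, \forall h \near 0^'+,
    forall (j : int) (x0 dt : R) (n : nat),
      xmin <= x0 <= xmax -> 0 < dt -> a * dt / h <= 1 -> n%:R * dt <= T ->
      let m := CutMesh h alpha kappa j x0 in
      (sup_norm (fun i : int => (trunc_um m a dt p taus eps u n i
                          - trunc_base m a dt u n i)%R) <= (C * h)%:E)%E.
Proof.
(* For [h <= 1] the three cells stay in [xmin - 2, xmax + 1]. *)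
have [L L0 lip] := smooth_lipschitz_x T (xmin - 2) (xmax + 1) hu.
exists ((3 + alpha^-1) * (4 * L)).
near=> h => j x0 dt n hx0 dt0 cfl nT.
set m := CutMesh h alpha kappa j x0; cbv zeta.
have h0 : 0 < h by [].
have h1 : h <= 1 by near: h; exact: nbhs_right_le.
set t := n%:R * dt in nT.
have ht : 0 <= t <= T by rewrite mulr_ge0 ?(ltW dt0)//.
have close i : i \in [:: j; j - 1; j - 1 - 1] ->
    `|grid_avg m u t i - u (t, x0)| <= 2 * L * h.
  move=> hi; apply: (@grid_avg_dist_le R m) => //=; try lra.
    have [_ [_ dux _ _]] := hu 1%N; move=> x.
    by apply/differentiable_continuous/derivable1_diffP; exact: dux.
  by move=> x hx; apply: lip => //; lra.
have jump i k : i \in [:: j; j - 1; j - 1 - 1] ->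
    k \in [:: j; j - 1; j - 1 - 1] ->
    `|grid_avg m u t i - grid_avg m u t k| <= 4 * L * h.
  move=> /close + /close; rewrite !ler_norml; lra.
apply: ge_ereal_sup => _ [i _ <-]; rewrite lee_fin trunc_diffE.
have [s0 s1] := andP (blending_itv m p eps (grid_avg m u t)
  (base_step m a dt (grid_avg m u t)) htaus).
rewrite normrM ger0_norm//.
apply: le_trans (ler_piMl (normr_ge0 _) s1) _.
apply: le_trans (srd_dist_le _ _ _) _; first by rewrite /=; lra.
rewrite -mulrA; apply: base_step_jump_le => //=; try lra.
- by rewrite cfl andbT divr_ge0 ?mulr_ge0 ?ltW.
- by apply: jump; rewrite !inE eqxx ?orbT.
- by apply: jump; rewrite !inE eqxx ?orbT.
Unshelve. all: by end_near.
Qed.
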